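(* Let $p>5$ be a prime, let $(G,T)$ be a group of $GM(p)$-type, let $\mathbb{F}$ be a field, let $\eta\in\mathbb{F}$ be such that $\mathbb{F}$ has good characteristic relative to $(p,\eta)$, and let $A=A_{\mathbb{F}}(G,T,\eta)$. Then, for any such value of the parameter $\eta$, no idempotent in $T$ is a left $\mathcal{M}(\alpha,-\alpha)$-axis of $A$ (for any $\alpha\in\mathbb{F}$).
   Context: Groups. A pair $(G,T)$ is a faithful odd transposition group if $G$ is a periodic group, $T$ is a normal (conjugation-invariant) subset of involutions of $G$ with $\langle T\rangle=G$, and $|ab|$ is odd for any $a,b\in T$. It is of $GM(p)$-type if $|ab|=p$ for any two distinct $a,b\in T$. Write $a^b=b^{-1}ab$, and let $I(a,b)$ be the set of all involutions of $\langle a,b\rangle$. Algebra. Fields have characteristic not $2$; algebras are not assumed associative or commutative. $A_{\mathbb{F}}(G,T,\eta)$ (for $\eta\in\mathbb{F}\setminus\{0,1\}$) is the $\mathbb{F}$-algebra with basis $T$ and bilinear product $a*a=a$, and $a*b=b^a+\eta\sum_{x\in I(a,b)\setminus\{b^a\}}x$ for $a\ne b$ in $T$. The field $\mathbb{F}$ has good characteristic relative to $(p,\eta)$ if $1,\ \eta(p-2)+1,\ \eta-1,\ 1-\eta$ are distinct in $\mathbb{F}$. Axes. A fusion law is a finite set $\mathcal{F}\subseteq\mathbb{F}$ with a map $\circ:\mathcal{F}\times\mathcal{F}\to 2^{\mathcal{F}}$. For an idempotent $a$ let $L_a(x)=a*x$, $R_a(x)=x*a$, $A_\lambda(L_a)=\{v:a*v=\lambda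 v\}$ (similarly for $R_a$), and $A_\Omega(L_a)=\bigoplus_{\lambda\in\Omega}A_\lambda(L_a)$. The idempotent $a$ is primitive if $\dim A_1(L_a)=\dim A_1(R_a)=1$. A left $(\mathcal{F},\circ)$-axis is a primitive idempotent $a$ with $A=A_{\mathcal{F}}(L_a)$ (so $L_a$ is semisimple) such that $x*y\in A_{\alpha\circ\beta}(L_a)$ for all $\alpha,\beta\in\mathcal{F}$, $x\in A_\alpha(L_a)$, $y\in A_\beta(L_a)$. The Monster type fusion law $\mathcal{M}(\alpha,\beta)$ is the symmetric law on $\{1,0,\alpha,\beta\}$ given by $1\circ1=\{1\}$, $1\circ0=\varnothing$, $1\circ\alpha=\{\alpha\}$, $1\circ\beta=\{\beta\}$, $0\circ0=\{0\}$, $0\circ\alpha=\{\alpha\}$, $0\circ\beta=\{\beta\}$, $\alpha\circ\alpha=\{1,0\}$, $\alpha\circ\beta=\{\beta\}$, $\beta\circ\beta=\{1,0,\alpha\}$.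
   Formalization: The set T is additionally assumed to contain at least two elements; if T={a}, then A is just the field with unit a, and a is a left M(α,-α)-axis, so the claim fails there. *)

(* Defs.v *)
From mathcomp Require Import all_boot all_algebra finmap.
From mathcomp Require Import boolp classical_sets cardinality fsbigop.
From mathcomp.multinomials Require Import monalg.

Set Implicit Arguments.
Unset Strict Implicit.
Unset Printing Implicit Defensive.

Import GRing.Theory.

Local Open Scope classical_set_scope.
Local Open Scope ring_scope.

Section Groups.
Local Open Scope group_scope.
Variable G : groupType.
Implicit Types (x y a b : G) (n p : nat) (S T : set G).

(* MathComp's #[x] is only available in finite groups, and G may be infinite. *)
Definition has_order x n : Prop :=
  [/\ (0 < n)%N, x ^+ n = 1 & forall m, (0 < m < n)%N -> x ^+ m <> 1].

Definition involution x : Prop := has_order x 2.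

Definition periodic : Prop := forall x, exists n, has_order x n.

Definition generated S : set G :=
  smallest [set H : set G | group_closed (mem H)] S.

(* The conjugate x ^ y of MathComp is y^-1 * (x * y). *)
Record faithful_odd_transposition (T : set G) : Prop := FaithfulOddTransposition {
  fot_periodic : periodic;
  fot_normal : forall a x, T a -> T (a ^ x);
  fot_involution : forall a, T a -> involution a;
  fot_generated : generated T = [set: G];
  fot_odd : forall a b, T a -> T b -> exists2 n, odd n & has_order (a * b) n
}.

Record GM_type p T : Prop := GMType {
  GM_fot :> faithful_odd_transposition T;
  GM_order : forall a b, T a -> T b -> a <> b -> has_order (a * b) p
}.

Definition dihedral_involutions a b : set G :=
  [set x | involution x /\ generated [set a; b] x].

End Groups.

Section NonassociativeAlgebra.
Variables (F : fieldType) (A : lmodType F).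
Implicit Types (f : A -> A) (mul : A -> A -> A) (a : A) (Omega : {fset F}).

Definition eigen f (lambda : F) : set A := [set v | f v = lambda *: v].

(* Eigenspaces for distinct eigenvalues are independent, so this sum is direct. *)
Definition eigen_sum f Omega : set A :=
  [set v | exists2 w : F -> A, (forall lambda, lambda \in Omega ->
      eigen f lambda (w lambda)) & v = \sum_(lambda <- Omega) w lambda].

Definition dim1 (E : set A) : Prop :=
  exists2 v : A, v != 0 & E = range (fun c : F => c *: v).

Definition idempotent_elt mul a : Prop := mul a a = a.

Definition primitive mul a : Prop :=
  dim1 (eigen (fun x => mul a x) 1) /\ dim1 (eigen (fun x => mul x a) 1).

Record fusion_law : Type := FusionLaw {
  fusion_set : {fset F};
  fusion_op : F -> F -> {fset F};
  fusion_op_sub : forall lambda mu, lambda \in fusion_set -> mu \in fusion_set ->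
    fsubset (fusion_op lambda mu) fusion_set
}.

Definition left_axis mul (L : fusion_law) a : Prop :=
  let La x := mul a x in
  [/\ idempotent_elt mul a,
      primitive mul a,
      eigen_sum La (fusion_set L) = [set: A]
    & forall lambda mu, lambda \in fusion_set L -> mu \in fusion_set L ->
      forall x y, eigen La lambda x -> eigen La mu y ->
        eigen_sum La (fusion_op L lambda mu) (mul x y)].

End NonassociativeAlgebra.

Section MonsterLaw.
Variables (F : fieldType) (alpha beta : F).

Definition monster_set : {fset F} := [fset (1 : F); 0; alpha; beta]%fset.

Definition monster_table : seq (F * F * seq F) :=
  [:: (1, 1, [:: 1]);
      (1, 0, [::]);
      (1, alpha, [:: alpha]);
      (1, beta, [:: beta]);
      (0, 0, [:: 0]);
      (0, alpha, [:: alpha]);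
      (0, beta, [:: beta]);
      (alpha, alpha, [:: 1; 0]);
      (alpha, beta, [:: beta]);
      (beta, beta, [:: 1; 0; alpha])].

(* Each entry (u, v, s) means that u o v = v o u = s.  If 1, 0, alpha, beta are
   not distinct, several entries may apply to the same pair; their union is
   then taken, which is the weakest resolution of the conflict. *)
Definition monster_op (lambda mu : F) : {fset F} :=
  [fset z in monster_set |
    has (fun e => (((lambda, mu) == e.1) || ((mu, lambda) == e.1))
                  && (z \in e.2)) monster_table]%fset.

Lemma monster_op_sub lambda mu : lambda \in monster_set -> mu \in monster_set ->
  fsubset (monster_op lambda mu) monster_set.
Proof. by move=> _ _; exact: fset_sub. Qed.

Definition monster_law : fusion_law F := FusionLaw monster_op_sub.

End MonsterLaw.

Section TranspositionAlgebra.
Variables (F : fieldType) (eta : F) (G : groupType) (T : set G).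
Hypothesis GT : faithful_odd_transposition T.

Definition conjT (b a : T) : T :=
  exist _ (val b ^ val a)%g
    (mem_set (fot_normal GT (val a) (set_mem (valP b)))).

(* {malg F[T]} is the free F-module on the subtype T of G. *)
Definition basisT (x : T) : {malg F[T]} := << x >>.

(* Since |ab| is odd, every involution of <a, b> is conjugate to a in <a, b>,
   hence lies in T; so the x : T below range over all of I(a, b) minus b^a,
   which is finite because <a, b> is a finite dihedral group. *)
Definition mul_basis (a b : T) : {malg F[T]} :=
  if a == b then basisT a
  else basisT (conjT b a) +
    eta *: \sum_(x \in [set x : T | dihedral_involutions (val a) (val b) (val x)]
                       `\ conjT b a) basisT x.

Definition transp_mul (u v : {malg F[T]}) : {malg F[T]} :=
  \sum_(a <- msupp u) \sum_(b <- msupp v) (u@_a * v@_b) *: mul_basis a b.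

End TranspositionAlgebra.

Definition good_characteristic (F : fieldType) (p : nat) (eta : F) : Prop :=
  uniq [:: 1; eta * (p%:R - 2%:R) + 1; eta - 1; 1 - eta].

(* Main.v *)
From HB Require Import structures.
Require Import Defs.
From mathcomp Require Import all_boot all_algebra finmap.
From mathcomp Require Import ring.
From mathcomp Require Import boolp classical_sets fsbigop.
From mathcomp.multinomials Require Import monalg.

Set Implicit Arguments.
Unset Strict Implicit.
Unset Printing Implicit Defensive.

Import GRing.Theory.

Local Open Scope classical_set_scope.
Local Open Scope ring_scope.

(** Suppose that the transposition [a] is an axis for the Monster law of type
    (alpha, - alpha), and pick another transposition [b].  The group generated
    by [a] and [b] is dihedral of order [2 * p]; its involutions [t i] are
    indexed by [i : 'F_p], with [t 0 = a], and conjugating [t j] by [t i] gives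
    [t (2i - j)].  They all lie in [T], and they span a subalgebra [D] in which,
    with [s] the sum of all [t k],
      [t i * t i = t i] and [t i * t j = (1 - eta) t (2i - j) + eta s]
    whenever [i] and [j] differ.
    A product in [D] is thus a twisted convolution of coefficient functions on
    ['F_p] ([dih_elt_mul]), and the theorem reduces to computing with such
    functions.

    Left multiplication by [a] acts on the functions of sum zero that vanish
    at [0] as [1 - eta] on the even ones and as [eta - 1] on the odd ones
    ([dih_eigen]).  As eigenspaces are independent, the eigenvalue [1 - eta]
    belongs to the fusion law ([eigen_sum_mem]); since [1 - eta] is neither [0]
    nor [1], it is [alpha] or [- alpha].

    The contradiction comes in both cases from the rule that alpha o alpha is
    contained in {1, 0}: left multiplication by [a] acts idempotently on the
    product of two alpha-eigenvectors ([eigen_sum01]), and, if this product is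
    an element of [D] with even coefficient function, the function is constant
    off [0] ([dih_elt_const]).
    - If [alpha = 1 - eta], then the even vectors
      [t 1 + t (-1) - t 2 - t (-2)] and [t 1 + t (-1) - t 3 - t (-3)] have a
      product whose coefficients at [t 1] and [t 3] differ by [1]
      ([even_vec_mul]).
    - If [alpha = eta - 1], then the square of the odd vector [t 1 - t (-1)] has
      coefficients at [t 1] and [t 2] that differ by [1] ([odd_vec_mul]).
    Both computations need that small integers that are distinct remain
    distinct modulo [p]; the differences that occur have no prime factor above
    [5], which is where [5 < p] enters. *)

(** * Sums of eigenspaces *)

Section EigenSum.
Variables (F : fieldType) (V : lmodType F) (f : {linear V -> V}).

(** Eigenspaces are independent: applying [f - l] for each [l] of [Omega] in
    turn kills the sum but only rescales an eigenvector for [mu] by [mu - l].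
    The induction below peels off one such factor at a time. *)
Lemma eigen_sum_mem (Omega : {fset F}) (mu : F) (v : V) :
  eigen_sum f Omega v -> eigen f mu v -> v != 0 -> mu \in Omega.
Proof.
move=> [w fw v_eq] fv; apply: contra_neqT => muN.
have {fw} : forall l, l \in enum_fset Omega -> f (w l) = l *: w l by move=> l /fw.
have {muN} : mu \notin enum_fset Omega by [].
move: fv v_eq; rewrite /eigen /=.
elim: (enum_fset Omega) w v => [|l s IH] w v fv.
  by rewrite big_nil.
rewrite big_cons inE negb_or => v_eq /andP[mul mus] fw.
have fws l' : l' \in s -> f (w l') = l' *: w l'.
  by move=> l's; apply: fw; rewrite inE l's orbT.
have : (mu - l) *: v = 0.
  apply: (IH (fun l' => (l' - l) *: w l')) => //.
  - by rewrite linearZ /= fv !scalerA mulrC.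
  - rewrite scalerBl -fv v_eq linearD scalerDr /= linear_sum scaler_sumr.
    rewrite fw ?mem_head// opprD addrACA subrr add0r -sumrB.
    apply: eq_big_seq => l' l's.
    by rewrite fws// scalerBl.
  - by move=> l' l's; rewrite linearZ /= fws// !scalerA mulrC.
by move=> /eqP; rewrite scaler_eq0 subr_eq0 (negPf mul) => /eqP.
Qed.

(** This form of membership in the sum of the eigenspaces for [0] and [1]
    is an equation, so it can be tested on coefficients. *)
Lemma eigen_sum01 (Omega : {fset F}) (v : V) :
  (forall l, l \in Omega -> l = 0 \/ l = 1) -> eigen_sum f Omega v ->
  f (f v) = f v.
Proof.
move=> Omega01 [w fw ->]; rewrite !linear_sum.
apply: eq_big_seq => l lO; have := fw l lO; rewrite /eigen /= => ->.
rewrite linearZ /= (fw l lO).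
by case: (Omega01 l lO) => ->; rewrite ?scale0r ?scale1r.
Qed.

End EigenSum.

(** * The dihedral algebra as an algebra of functions on the prime field *)

Section DihedralProduct.
Variables (F : fieldType) (p : nat) (eta : F).
Implicit Types (c d : 'F_p -> F) (k : 'F_p).

(** The product of the coefficient functions of [\sum_i c i t_i] and
    [\sum_j d j t_j].  Up to a constant it is the twisted convolution coming
    from [t_i * t_j = (1 - eta) t_(2i - j) + eta s], taken over all pairs; the
    middle term corrects the diagonal, where [t_i * t_i = t_i]. *)
Definition dih_mul c d k : F :=
  (1 - eta) * (\sum_i c i * d (i *+ 2 - k)) + eta * c k * d k
  + eta * (\sum_i \sum_(j | j != i) c i * d j).

Definition delta (i : 'F_p) : 'F_p -> F := fun k => (k == i)%:R.

Lemma sum_delta (i : 'F_p) (g : 'F_p -> F) : \sum_j delta i j * g j = g i.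
Proof.
rewrite (bigD1 i) //= /delta eqxx mul1r big1 ?addr0// => j /negPf ->.
by rewrite mul0r.
Qed.

Lemma dih_mul_delta0 d k : dih_mul (delta 0) d k =
  (1 - eta) * d (- k) + eta * delta 0 k * d 0 + eta * (\sum_(j | j != 0) d j).
Proof.
rewrite /dih_mul sum_delta mul0rn sub0r.
under [X in _ + eta * X]eq_bigr do rewrite -mulr_sumr.
rewrite (sum_delta 0 (fun i => \sum_(j | j != i) d j)).
congr (_ + _ + _); rewrite -!mulrA; congr (_ * _).
by rewrite /delta; case: eqP => [->|]; rewrite // !mul0r.
Qed.

(** On functions of sum zero vanishing at [0], multiplication by [t_0] is
    [1 - eta] times the reflection [k |-> - k], so parity decides the
    eigenvalue. *)
Lemma dih_eigen (eps : F) d k : d 0 = 0 -> \sum_j d j = 0 ->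
  (forall i, d (- i) = eps * d i) ->
  dih_mul (delta 0) d k = eps * (1 - eta) * d k.
Proof.
move=> d0; rewrite (bigD1 0) //= d0 add0r => sd dN.
by rewrite dih_mul_delta0 sd dN d0; ring.
Qed.

(** Reflecting indices is the automorphism induced by conjugation by [a]; it
    fixes the product when it multiplies both factors by the same sign. *)
Lemma dih_mulN (eps : F) c d k : eps ^+ 2 = 1 ->
  (forall i, c (- i) = eps * c i) -> (forall i, d (- i) = eps * d i) ->
  dih_mul c d (- k) = dih_mul c d k.
Proof.
move=> eps1 cN dN.
have NN x y : eps * x * (eps * y) = x * y.
  by rewrite mulrACA -expr2 eps1 mul1r.
rewrite /dih_mul cN dN (reindex_inj oppr_inj) /=.
congr (_ * _ + _ + _).
  apply: eq_bigr => i _.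
  by rewrite mulNrn -opprD cN dN NN.
by rewrite -(mulrA eta (eps * _)) NN mulrA.
Qed.

(** Off [0], multiplication by [t_0] acts on an even function as [1 - eta] plus
    a constant.  Idempotence hence makes [(1 - eta)^2 - (1 - eta)] kill the
    difference of any two values, and this factor is nonzero. *)
Lemma dih_idem_const (y : 'F_p -> F) k l :
  eta != 0 -> eta != 1 -> (forall i, y (- i) = y i) ->
  (forall i, dih_mul (delta 0) (dih_mul (delta 0) y) i = dih_mul (delta 0) y i) ->
  k != 0 -> l != 0 -> y k = y l.
Proof.
move=> eta0 eta1 yN yLL k0 l0.
have Ly i : i != 0 -> dih_mul (delta 0) y i =
    (1 - eta) * y i + eta * (\sum_(j | j != 0) y j).
  by move=> i0; rewrite dih_mul_delta0 yN /delta (negPf i0) mulr0 mul0r addr0.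
have LLy i : i != 0 -> dih_mul (delta 0) (dih_mul (delta 0) y) i =
    (1 - eta) * dih_mul (delta 0) y i
    + eta * (\sum_(j | j != 0) dih_mul (delta 0) y j).
  move=> i0; rewrite dih_mul_delta0 [delta 0 i]/delta (negPf i0) mulr0 mul0r addr0.
  by rewrite !Ly ?oppr_eq0// yN.
have := yLL k; have := yLL l; rewrite !LLy// !Ly//.
set s := \sum_(_ | _) _; set s' := \sum_(_ | _) _ => /eqP yl /eqP yk.
have : eta * (eta - 1) * (y k - y l) = 0.
  rewrite -subr_eq0 in yl; rewrite -subr_eq0 in yk.
  move/eqP: yl => yl; move/eqP: yk => yk.
  by rewrite -[RHS](subrr 0) -{1}yk -yl; ring.
move/eqP; rewrite !mulf_eq0 (negPf eta0) !subr_eq0 (negPf eta1) /=.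
by move/eqP.
Qed.

End DihedralProduct.

(** * The dihedral group generated by two transpositions *)

Section DihedralGroup.
Local Open Scope group_scope.
Variables (G : groupType) (p : nat) (a b : G).
Hypotheses (p_prime : prime p) (p_gt2 : (2 < p)%N)
  (a_inv : involution a) (b_inv : involution b) (ab_order : has_order (a * b) p).
Implicit Types i j k : 'F_p.

Definition rotation i : G := (a * b) ^+ i.
Definition reflection i : G := a * rotation i.

Lemma involution_sqr (x : G) : involution x -> x * x = 1.
Proof. by move=> [_]; rewrite expg2. Qed.

Lemma rotation0 : rotation 0 = 1.
Proof. by []. Qed.

Lemma rotationD i j : rotation (i + j) = rotation i * rotation j.
Proof.
have [_ rp _] := ab_order.
rewrite /rotation -expgnDr [in RHS](divn_eq (i + j) p) expgnDr mulnC expgnA.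
rewrite rp expg1n mul1g.
by congr (_ ^+ modn _ _); exact: Fp_cast.
Qed.

Lemma rotationN i : rotation (- i) = (rotation i)^-1.
Proof. by apply/esym/mulg1_eq; rewrite -rotationD subrr. Qed.

Lemma rotationX i n : rotation (i *+ n)%R = rotation i ^+ n.
Proof. by elim: n => [|n IH]; rewrite ?mulr0n// mulrS rotationD IH expgS. Qed.

Lemma rotation_inj : injective rotation.
Proof.
move=> i j ij; have [_ _ rmin] := ab_order.
apply/eqP; rewrite -subr_eq0; apply/eqP/val_inj => /=.
have : rotation (i - j) = 1 by rewrite rotationD rotationN ij mulgV.
have /= := ltn_ord (i - j)%R; rewrite [X in (_ < X)%N](Fp_cast p_prime).
case: (posnP (i - j)%R) => // ij0 ijp.
by move/(rmin (i - j)%R); rewrite ij0 ijp => /(_ isT).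
Qed.

Lemma rotation_conj i : a * rotation i = rotation (- i) * a.
Proof.
have aa := involution_sqr a_inv; have bb := involution_sqr b_inv.
have aV : a^-1 = a by exact: mulg1_eq.
have bV : b^-1 = b by exact: mulg1_eq.
have : rotation i ^ a = rotation (- i).
  rewrite rotationN /rotation conjXg -expVgn invgM aV bV conjgE aV.
  by rewrite !mulgA aa mul1g.
by rewrite conjgE aV => <-; rewrite -!mulgA aa mulg1.
Qed.

Lemma reflection0 : reflection 0 = a.
Proof. by rewrite /reflection rotation0 mulg1. Qed.

Lemma reflection_rotation i j : reflection i * rotation j = reflection (i + j).
Proof. by rewrite /reflection rotationD mulgA. Qed.

Lemma rotation_reflection i j : rotation i * reflection j = reflection (j - i).
Proof.
by rewrite /reflection mulgA -[i in LHS]opprK -rotation_conj -mulgA -rotationD addrC.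
Qed.

Lemma reflection_mul i j : reflection i * reflection j = rotation (j - i).
Proof.
rewrite {1}/reflection -mulgA rotation_reflection /reflection mulgA.
by rewrite involution_sqr// mul1g.
Qed.

Lemma reflectionV i : (reflection i)^-1 = reflection i.
Proof. by apply: mulg1_eq; rewrite reflection_mul subrr. Qed.

Lemma reflection_conj i j : reflection j ^ reflection i = reflection (i *+ 2 - j).
Proof. by rewrite conjgE reflectionV reflection_mul reflection_rotation mulr2n addrA. Qed.

Lemma reflection_inj : injective reflection.
Proof. by move=> i j /mulgI /rotation_inj. Qed.

Lemma two_neq0_Fp : (2%:R : 'F_p) != 0.
Proof.
by rewrite -(dvdn_pcharf (pchar_Fp p_prime)) gtnNdvd.
Qed.

(** Since [p] is odd, every involution of the dihedral group is conjugate to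
    [a]; this is how all of them are found in [T]. *)
Lemma reflection_half i : reflection i = a ^ rotation (i / 2%:R)%R.
Proof.
rewrite conjgE -/(reflection _) -rotationN rotation_reflection opprK; congr reflection.
by field; exact: two_neq0_Fp.
Qed.

Lemma rotation_noninvolution i : ~ involution (rotation i).
Proof.
move=> ri; have := involution_sqr ri; rewrite -rotationD -rotation0 => /rotation_inj ii.
have i0 : i = 0.
  apply/eqP; move/eqP: ii; rewrite -mulr2n -mulr_natl mulf_eq0.
  by rewrite (negPf two_neq0_Fp).
by have [_ _ /(_ 1%N isT)] := ri; rewrite i0 rotation0 expg1n.
Qed.

(** As [p] is prime, any two distinct reflections generate the whole dihedral
    group: their product is a nontrivial rotation, and the power
    [(k - i) / (j - i)] of it moves reflection [i] to reflection [k]. *)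
Lemma reflection_generated i j k : i != j ->
  generated [set reflection i; reflection j]%classic (reflection k).
Proof.
move=> ij H [Hgrp] Hij; have HM := group_closedM Hgrp.
have Hi : reflection i \in H by apply/mem_set/Hij; left.
have Hj : reflection j \in H by apply/mem_set/Hij; right.
have ji : (j - i)%R != 0 by rewrite subr_eq0 eq_sym.
have HX x n : x \in H -> x ^+ n \in H.
  by move=> Hx; elim: n => [|n IH]; [exact: Hgrp.1 | rewrite expgS; exact: HM].
have := HX _ ((k - i) / (j - i))%R (HM _ _ Hi Hj); rewrite reflection_mul -rotationX.
rewrite -mulr_natr natr_Zp mulrC mulfVK// => Hki.
by have := HM _ _ Hi Hki; rewrite reflection_rotation addrC subrK => /set_mem.
Qed.

Lemma generated_reflection i j x : generated [set reflection i; reflection j]%classic x ->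
  (exists k, x = rotation k) \/ (exists k, x = reflection k).
Proof.
pose D := [set x | (exists k, x = rotation k) \/ (exists k, x = reflection k)]%classic.
apply: (smallest_sub (X := D)).
  split; first by apply/mem_set; left; exists 0%R.
  move=> y z /set_mem/= [] [k ->] /set_mem/= [] [l ->]; apply/mem_set => /=.
  - by left; exists (k - l)%R; rewrite rotationD rotationN.
  - by right; exists (l - k)%R; rewrite reflectionV rotation_reflection.
  - by right; exists (k - l)%R; rewrite -rotationN reflection_rotation.
  - by left; exists (l - k)%R; rewrite reflectionV reflection_mul.
by move=> y [|] ->; right; eexists.
Qed.

End DihedralGroup.

(** * Bilinearity of the product *)

Section Bilinearity.
Variables (F : fieldType) (eta : F) (G : groupType) (T : set G).
Variable GT : faithful_odd_transposition T.
Implicit Types u v w : {malg F[T]}.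
Local Notation mul := (transp_mul eta GT).

(** The product is a sum over the supports of its factors; enlarging the
    ranges to common finite sets gives access to linearity. *)
Lemma transp_mulEw (X Y : {fset T}) u v :
  (msupp u `<=` X)%fset -> (msupp v `<=` Y)%fset ->
  mul u v = \sum_(x <- X) \sum_(y <- Y) (u@_x * v@_y) *: mul_basis eta GT x y.
Proof.
move=> uX vY; rewrite /transp_mul (big_fset_incl _ uX) /=.
  apply/eq_bigr=> x _; apply/big_fset_incl => // y _ /mcoeff_outdom ->.
  by rewrite mulr0 scale0r.
move=> x _ /mcoeff_outdom ux.
by rewrite big1 => // y _; rewrite ux mul0r scale0r.
Qed.

Lemma transp_mul_linear u : linear (mul u).
Proof.
move=> k v w; pose Y := (msupp (k *: v + w) `|` (msupp v `|` msupp w))%fset.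
have [kvY vY wY] : [/\ (msupp (k *: v + w) `<=` Y)%fset,
    (msupp v `<=` Y)%fset & (msupp w `<=` Y)%fset].
  by split; apply/fsubsetP => x xs; rewrite !in_fsetU xs ?orbT.
have uu := fsubset_refl (msupp u).
rewrite (transp_mulEw uu kvY) (transp_mulEw uu vY) (transp_mulEw uu wY).
rewrite scaler_sumr -big_split; apply: eq_bigr => x _ /=.
rewrite scaler_sumr -big_split; apply: eq_bigr => y _ /=.
by rewrite mcoeffD mcoeffZ mulrDr scalerDl scalerA mulrCA.
Qed.

HB.instance Definition _ u :=
  GRing.isLinear.Build F {malg F[T]} {malg F[T]} _ (mul u) (transp_mul_linear u).

Lemma transp_mul_linear_l v : linear (mul ^~ v).
Proof.
move=> k u w; pose X := (msupp (k *: u + w) `|` (msupp u `|` msupp w))%fset.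
have [kuX uX wX] : [/\ (msupp (k *: u + w) `<=` X)%fset,
    (msupp u `<=` X)%fset & (msupp w `<=` X)%fset].
  by split; apply/fsubsetP => x xs; rewrite !in_fsetU xs ?orbT.
have vv := fsubset_refl (msupp v).
rewrite (transp_mulEw kuX vv) (transp_mulEw uX vv) (transp_mulEw wX vv).
rewrite scaler_sumr -big_split; apply: eq_bigr => x _ /=.
rewrite scaler_sumr -big_split; apply: eq_bigr => y _ /=.
by rewrite mcoeffD mcoeffZ mulrDl scalerDl scalerA mulrA.
Qed.

Lemma transp_mul_suml (I : finType) (c : I -> F) (u : I -> {malg F[T]}) v :
  mul (\sum_i c i *: u i) v = \sum_i c i *: mul (u i) v.
Proof.
pose g := HB.pack_for {linear {malg F[T]} -> {malg F[T]}} (mul ^~ v)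
  (GRing.isLinear.Build F {malg F[T]} {malg F[T]} _ (mul ^~ v) (transp_mul_linear_l v)).
rewrite -[LHS]/(g _) linear_sum; apply: eq_bigr => i _.
by rewrite linearZ.
Qed.

Lemma transp_mul_sumr (I : finType) (c : I -> F) u (v : I -> {malg F[T]}) :
  mul u (\sum_i c i *: v i) = \sum_i c i *: mul u (v i).
Proof.
pose g : {linear {malg F[T]} -> {malg F[T]}} := mul u.
rewrite -[LHS]/(g _) linear_sum; apply: eq_bigr => i _.
by rewrite linearZ.
Qed.

Lemma transp_mul_basis (x y : T) : mul (basisT F x) (basisT F y) = mul_basis eta GT x y.
Proof.
have xx : (msupp (basisT F x) `<=` [fset x])%fset := msuppU_le.
have yy : (msupp (basisT F y) `<=` [fset y])%fset := msuppU_le.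
by rewrite (transp_mulEw xx yy) !big_seq_fset1 !mcoeffUU mulr1 scale1r.
Qed.

End Bilinearity.

(** * The subalgebra spanned by the involutions of a dihedral group *)

Lemma coef_scale_basis (F : fieldType) (G : groupType) (T : set G) (c : F) (x y : T) :
  (c *: basisT F x)@_y = c * (x == y)%:R.
Proof. by rewrite [LHS]mcoeffZ mcoeffU. Qed.

Section DihedralSubalgebra.
Variables (p : nat) (F : fieldType) (eta : F) (G : groupType) (T : set G).
Hypotheses (p_prime : prime p) (p_gt2 : (2 < p)%N) (GT : GM_type p T).
Variables (a b : G).
Hypotheses (Ta : T a) (Tb : T b) (ab : a <> b).
Implicit Types (i j k : 'F_p) (c d : 'F_p -> F).

Let a_inv := fot_involution GT Ta.
Let b_inv := fot_involution GT Tb.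
Let ab_order := GM_order GT Ta Tb ab.

Lemma reflection_transposition i : T (reflection a b i).
Proof. by rewrite (reflection_half p_prime)//; apply: (fot_normal GT). Qed.

Definition reflectionT i : T :=
  exist _ (reflection a b i) (mem_set (reflection_transposition i)).

Lemma reflectionT_inj : injective reflectionT.
Proof. by move=> i j /(congr1 val) /= /(reflection_inj p_prime ab_order). Qed.

Lemma reflectionT_conj i j : conjT GT (reflectionT j) (reflectionT i) = reflectionT (i *+ 2 - j).
Proof. by apply/val_inj => /=; rewrite (reflection_conj p_prime). Qed.

Lemma dihedral_involutions_reflection i j : i != j ->
  [set x : T | dihedral_involutions (reflection a b i) (reflection a b j) (val x)]
  = range reflectionT.
Proof.
move=> ij; apply/seteqP; split => x /=.
  move=> [x_inv /(generated_reflection p_prime a_inv b_inv ab_order)[|] [k xk]].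
    by move: x_inv; rewrite xk => /(rotation_noninvolution p_prime p_gt2 ab_order).
  by exists k => //; apply/val_inj; rewrite /= xk.
move=> [k _ <-]; split; first exact: (fot_involution GT (reflection_transposition k)).
exact: reflection_generated.
Qed.

Lemma mul_basis_reflection i j : mul_basis eta GT (reflectionT i) (reflectionT j) =
  \sum_k (if i == j then (k == i)%:R
          else (1 - eta) * (k == i *+ 2 - j)%:R + eta) *: basisT F (reflectionT k).
Proof.
rewrite /mul_basis (inj_eq reflectionT_inj); case: eqP => [_|/eqP ij].
  rewrite (bigD1 i) //= eqxx scale1r big1 ?addr0// => k /negPf ->.
  by rewrite scale0r.
rewrite dihedral_involutions_reflection// reflectionT_conj.
set l := i *+ 2 - j.
have -> : range reflectionT `\ reflectionT l =
    reflectionT @` [set` [seq k <- enum 'F_p | k != l]].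
  apply/seteqP; split => x /=.
    move=> [[k _ <-] kl]; exists k => //=; rewrite mem_filter mem_enum andbT.
    by apply/eqP => kl'; apply: kl; rewrite /= kl'.
  move=> [k]; rewrite mem_filter => /andP[/eqP kl _] <-; split; first by exists k.
  by move=> /reflectionT_inj.
rewrite fsbig_image; last by move=> k k' _ _ /reflectionT_inj.
rewrite -fsbig_seq; last exact/filter_uniq/enum_uniq.
rewrite big_filter big_enum_cond /=.
rewrite [RHS](bigD1 l) //= eqxx mulr1 subrK scale1r scaler_sumr.
congr (_ + _); apply: eq_bigr => k /negPf ->.
by rewrite mulr0 add0r.
Qed.

Definition dih_elt c : {malg F[T]} := \sum_i c i *: basisT F (reflectionT i).

Lemma dih_eltE c k : (dih_elt c)@_(reflectionT k) = c k.
Proof.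
rewrite /dih_elt (raddf_sum (mcoeff (reflectionT k))) -[RHS](sum_delta k).
apply: eq_bigr => i _; apply: etrans (coef_scale_basis _ _ _) _.
by rewrite (inj_eq reflectionT_inj) mulrC.
Qed.

Lemma dih_elt_inj c d : dih_elt c = dih_elt d -> c =1 d.
Proof. by move=> cd k; rewrite -(dih_eltE c k) cd dih_eltE. Qed.

Lemma dih_elt_mul c d :
  transp_mul eta GT (dih_elt c) (dih_elt d) = dih_elt (dih_mul eta c d).
Proof.
rewrite transp_mul_suml.
under eq_bigr => i _.
  rewrite transp_mul_sumr.
  under eq_bigr => j _ do rewrite transp_mul_basis mul_basis_reflection scaler_sumr.
  rewrite exchange_big scaler_sumr.
  over.
rewrite exchange_big; apply: eq_bigr => k _ /=.
under eq_bigr => i _.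
  under eq_bigr => j _ do rewrite scalerA.
  rewrite -scaler_suml scalerA; over.
rewrite -scaler_suml; congr (_ *: _).
pose s i := \sum_(j | j != i) d j.
(* The row of [i]: extending the twisted sum to [j = i] costs a term
   [(1 - eta) d i] at [k = i], leaving [eta d i] there. *)
have E i : \sum_j d j * (if i == j then (k == i)%:R
      else (1 - eta) * (k == i *+ 2 - j)%:R + eta) =
    (1 - eta) * d (i *+ 2 - k) + eta * (delta F k i * d k) + eta * s i.
  have dk : (i *+ 2 - k == i) = (k == i).
    by rewrite -[LHS]subr_eq0 mulr2n addrAC addrK subr_eq0 eq_sym.
  rewrite (bigD1 i) //= eqxx.
  have -> : \sum_(j | j != i) d j * (if i == j then (k == i)%:R
      else (1 - eta) * (k == i *+ 2 - j)%:R + eta) =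
    (1 - eta) * (\sum_(j | j != i) d j * (j == i *+ 2 - k)%:R) + eta * s i.
    rewrite !mulr_sumr -big_split; apply: eq_bigr => j /negPf ji /=.
    rewrite eq_sym ji -[k == _]subr_eq0 -[j == _ - _]subr_eq0.
    have -> : k - (i *+ 2 - j) = j - (i *+ 2 - k) by ring.
    by ring.
  have -> : \sum_(j | j != i) d j * (j == i *+ 2 - k)%:R =
      d (i *+ 2 - k) - (k == i)%:R * d i.
    have := sum_delta (i *+ 2 - k) d; rewrite (bigD1 i) //= /delta.
    move=> <-; rewrite [i == _]eq_sym dk [RHS]addrAC subrr add0r.
    by apply: eq_bigr => j _; rewrite mulrC.
  rewrite /delta [i == k]eq_sym; by case: eqP => [->|_] /=; ring.
under eq_bigr do rewrite E !mulrDr.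
rewrite !big_split /= /dih_mul mulr_sumr mulr_sumr; congr (_ + _ + _).
- by apply: eq_bigr => i _; rewrite mulrCA.
- rewrite -(sum_delta k (fun i => eta * c i * d k)).
  by apply: eq_bigr => i _; ring.
- by apply: eq_bigr => i _; rewrite -mulr_sumr mulrCA.
Qed.

Lemma dih_elt_delta i : dih_elt (delta F i) = basisT F (reflectionT i).
Proof.
rewrite /dih_elt (bigD1 i) //= /delta eqxx scale1r big1 ?addr0// => j /negPf ->.
by rewrite scale0r.
Qed.

End DihedralSubalgebra.

(** * Test vectors *)

Section TestVectors.
Variables (p : nat) (F : fieldType) (eta : F).
Hypotheses (p_prime : prime p) (p_gt5 : (5 < p)%N).
Implicit Types m k : int.

Lemma dvdn_smooth n : (0 < n)%N -> all (leq^~ 5) (primes n) -> (p %| n)%N = false.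
Proof.
move=> n0 /allP n5; apply/negP => pn.
by have := n5 p; rewrite mem_primes p_prime n0 pn leqNgt p_gt5 => /(_ isT).
Qed.

(** With integer indices, equality in ['F_p] becomes divisibility of a concrete
    difference, which [dvdn_smooth] decides. *)
Lemma delta_int m k : delta F (m%:~R : 'F_p) k%:~R = (p %| absz (k - m))%N%:R.
Proof.
rewrite /delta -subr_eq0 -rmorphB /=; congr (nat_of_bool _)%:R.
rewrite (dvdn_pcharf (pchar_Fp p_prime)).
by case: (k - m) => l //; rewrite NegzE mulrNz oppr_eq0 abszN.
Qed.

(** The simplest functions of sum zero of either parity; [even_vec m] and
    [odd_vec] give eigenvectors for [1 - eta] and [eta - 1].  The indices are
    integers so that [delta_int] evaluates them. *)
Definition even_pair m (k : 'F_p) : F := delta F m%:~R k + delta F (- m)%:~R k.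
Definition even_vec m (k : 'F_p) : F := even_pair 1 k - even_pair m k.
Definition odd_vec (k : 'F_p) : F := delta F 1%:~R k - delta F (- 1)%:~R k.

Lemma deltaN (i k : 'F_p) : delta F i (- k) = delta F (- i) k.
Proof. by rewrite /delta eqr_oppLR. Qed.

Lemma even_vecN m (k : 'F_p) : even_vec m (- k) = 1 * even_vec m k.
Proof.
rewrite mul1r /even_vec /even_pair !deltaN -!rmorphN !opprK.
by rewrite !(addrC (delta F (- _)%:~R k)).
Qed.

Lemma odd_vecN (k : 'F_p) : odd_vec (- k) = - 1 * odd_vec k.
Proof. by rewrite mulN1r /odd_vec !deltaN -!rmorphN opprK opprB. Qed.

Lemma sum_even_vec m (g : 'F_p -> F) :
  \sum_i even_vec m i * g i =
  g 1%:~R + g (- 1)%:~R - (g m%:~R + g (- m)%:~R).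
Proof.
under eq_bigr do rewrite /even_vec /even_pair mulrBl !mulrDl.
by rewrite sumrB !big_split /= !sum_delta.
Qed.

Lemma sum_odd_vec (g : 'F_p -> F) :
  \sum_i odd_vec i * g i = g 1%:~R - g (- 1)%:~R.
Proof.
under eq_bigr do rewrite /odd_vec mulrBl.
by rewrite sumrB !sum_delta.
Qed.

Lemma even_vec_sum0 m : \sum_i even_vec m i = 0.
Proof.
under eq_bigr do rewrite -[even_vec _ _]mulr1.
by rewrite (sum_even_vec m (fun=> 1)) subrr.
Qed.

Lemma odd_vec_sum0 : \sum_i odd_vec i = 0.
Proof.
under eq_bigr do rewrite -[odd_vec _]mulr1.
by rewrite (sum_odd_vec (fun=> 1)) subrr.
Qed.

Lemma doubleB_int m k : (m%:~R *+ 2 - k%:~R : 'F_p) = (m *+ 2 - k)%:~R.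
Proof. by rewrite rmorphB rmorphMn. Qed.

Local Ltac evaluate :=
  rewrite ?doubleB_int ?delta_int /= ?dvdn0 ?dvdn_smooth//=.

Lemma even_vec_at0 (m : nat) : (0 < m)%N -> all (leq^~ 5) (primes m) ->
  even_vec (Posz m) 0 = 0.
Proof.
move=> m0 m5; rewrite /even_vec /even_pair -[0]/((0%:Z)%:~R) !delta_int.
by rewrite !sub0r !opprK !abszN /= !dvdn_smooth//; ring.
Qed.

Lemma odd_vec_at0 : odd_vec 0 = 0.
Proof. by rewrite /odd_vec -[0]/((0%:Z)%:~R); evaluate; ring. Qed.

(** The indices [2] and [3] are such that every difference of indices in this
    computation is at most [10] in absolute value and different from [7], so a
    single evaluation covers all [p > 5], including [p = 7].  The value is
    [1 - eta] from the convolution at [t_1], plus [eta] from the diagonal. *)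
Lemma even_vec_mul :
  dih_mul eta (even_vec 2) (even_vec 3) 1%:~R
  - dih_mul eta (even_vec 2) (even_vec 3) 3%:~R = 1.
Proof.
by rewrite /dih_mul !sum_even_vec /even_vec /even_pair; evaluate; ring.
Qed.

Lemma odd_vec_mul :
  dih_mul eta odd_vec odd_vec 1%:~R - dih_mul eta odd_vec odd_vec 2%:~R = 1.
Proof.
by rewrite /dih_mul !sum_odd_vec /odd_vec; evaluate; ring.
Qed.

Lemma even_vec2_at1 : even_vec 2 1%:~R = 1.
Proof. by rewrite /even_vec /even_pair; evaluate; ring. Qed.

Lemma smooth_neq0_Fp n : (0 < n)%N -> all (leq^~ 5) (primes n) ->
  ((n%:Z)%:~R : 'F_p) != 0.
Proof.
by move=> n0 n5; rewrite -(dvdn_pcharf (pchar_Fp p_prime)) dvdn_smooth.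
Qed.

End TestVectors.

(** * The fusion rule that fails *)

Section MonsterFusion.
Variables (F : fieldType) (alpha : F).

(** Under these conditions only the entry for (alpha, alpha) of the table
    applies. *)
Lemma monster_op_alpha l :
  alpha != 0 -> alpha != 1 -> alpha != - alpha ->
  l \in monster_op alpha (- alpha) alpha alpha -> l = 0 \/ l = 1.
Proof.
move=> a0 a1 aN; rewrite /monster_op /monster_table !inE /= => /andP[_].
rewrite !xpair_eqE (negPf a0) (negPf a1) (negPf aN) !eqxx /= ?inE ?orbF ?andbF.
by case/orP => /eqP; [right|left].
Qed.

End MonsterFusion.

Section Obstruction.
Variables (p : nat) (F : fieldType) (eta : F) (G : groupType) (T : set G).
Hypotheses (p_prime : prime p) (p_gt5 : (5 < p)%N) (GT : GM_type p T).
Hypotheses (eta_neq0 : eta != 0) (eta_neq1 : eta != 1).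
Variables (a b : T).
Hypothesis (ab : val a <> val b).
Implicit Types (c d : 'F_p -> F).

Let p_gt2 : (2 < p)%N := ltn_trans (isT : 2 < 5)%N p_gt5.
Let Ta := set_mem (valP a).
Let Tb := set_mem (valP b).
Local Notation mul := (transp_mul eta (GM_fot GT)).
Local Notation elt := (dih_elt (F := F) p_prime p_gt2 GT Ta Tb ab).

Lemma basis_axis : basisT F a = elt (delta F 0).
Proof.
by rewrite dih_elt_delta; congr (basisT F _); apply/val_inj; rewrite /= reflection0.
Qed.

Lemma dih_elt_eigen (eps : F) c : c 0 = 0 -> \sum_i c i = 0 ->
  (forall i, c (- i) = eps * c i) ->
  eigen (fun x => mul (basisT F a) x) (eps * (1 - eta)) (elt c).
Proof.
move=> c0 sc cN; rewrite /eigen /= basis_axis dih_elt_mul /dih_elt scaler_sumr.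
by apply: eq_bigr => i _; rewrite (dih_eigen _ _ c0 sc cN) scalerA.
Qed.

Lemma dih_elt_const c (k l : 'F_p) : (forall i, c (- i) = c i) ->
  mul (basisT F a) (mul (basisT F a) (elt c)) = mul (basisT F a) (elt c) ->
  k != 0 -> l != 0 -> c k = c l.
Proof.
have La d : mul (basisT F a) (elt d) = elt (dih_mul eta (delta F 0) d).
  by rewrite basis_axis; exact: dih_elt_mul.
rewrite (La c) (La (dih_mul _ _ c)) => cN idem.
exact: (dih_idem_const eta_neq0 eta_neq1 cN (dih_elt_inj idem)).
Qed.

End Obstruction.

Theorem proposition3 (p : nat) (G : groupType) (T : set G) (F : fieldType)
    (eta : F)
    (p_prime : prime p) (p_gt5 : (5 < p)%N)
    (GT : GM_type p T)
    (* T is not a singleton: if T = {a}, then A is F itself with unit a *)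
    (T_nontriv : exists a b, [/\ T a, T b & a <> b])
    (char_F : 2%N \notin [pchar F])
    (eta_neq0 : eta != 0) (eta_neq1 : eta != 1)
    (good : good_characteristic p eta) :
  forall (alpha : F) (a : T),
    ~ left_axis (transp_mul eta (GM_fot GT)) (monster_law alpha (- alpha)) (basisT F a).
Proof.
move=> alpha a [_ _ spanned fusion].
have [b ab] : exists b : T, val a <> val b.
  have [x [y [Tx Ty xy]]] := T_nontriv.
  have [ax|/eqP ax] := eqVneq (val a) x; last first.
    by exists (exist _ x (mem_set Tx)).
  by exists (exist _ y (mem_set Ty)) => /=; rewrite ax.
pose p_gt2 : (2 < p)%N := ltn_trans (isT : 2 < 5)%N p_gt5.
pose Ta := set_mem (valP a); pose Tb := set_mem (valP b).
pose t := reflectionT p_prime p_gt2 GT Ta Tb ab.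
pose elt := dih_elt (F := F) p_prime p_gt2 GT Ta Tb ab.
pose La : {linear {malg F[T]} -> {malg F[T]}} := transp_mul eta GT (basisT F a).
have ev_eigen m : (0 < m)%N -> all (leq^~ 5) (primes m) ->
    eigen La (1 - eta) (elt (even_vec F (Posz m))).
  move=> m0 m5; rewrite -[1 - eta]mul1r; apply: dih_elt_eigen.
  - exact: even_vec_at0.
  - exact: even_vec_sum0.
  - exact: even_vecN.
have od_eigen : eigen La (- (1 - eta)) (elt (@odd_vec p F)).
  rewrite -mulN1r; apply: dih_elt_eigen.
  - exact: odd_vec_at0.
  - exact: odd_vec_sum0.
  - exact: odd_vecN.
move: good; rewrite /good_characteristic /= !inE !negb_or !andbT.
move=> /andP[/and3P[_ one_neq_em one_neq_me] /andP[_ em_neq_me]].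
have one_sub_eta_neq0 : 1 - eta != 0 by rewrite subr_eq0 eq_sym.
(* [D] supplies a nonzero vector for [1 - eta], so the law must contain it. *)
have : 1 - eta \in monster_set alpha (- alpha).
  apply: (eigen_sum_mem (f := La) (v := elt (even_vec F 2))).
  - by have -> : eigen_sum La (monster_set alpha (- alpha)) = setT by exact: spanned.
  - exact: ev_eigen.
  - apply/eqP => e0.
    have := congr1 (mcoeff (t 1%:~R)) e0.
    rewrite dih_eltE even_vec2_at1// mcoeff0 => /eqP.
    by rewrite oner_eq0.
have alpha_mem : alpha \in monster_set alpha (- alpha) by rewrite !inE eqxx !orbT.
(* The rule for (alpha, alpha), read on coefficients of the product. *)
have prod_const c d (k l : 'F_p) : 1 - eta = alpha \/ 1 - eta = - alpha ->
    eigen La alpha (elt c) -> eigen La alpha (elt d) ->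
    (forall i, dih_mul eta c d (- i) = dih_mul eta c d i) ->
    k != 0 -> l != 0 -> dih_mul eta c d k = dih_mul eta c d l.
  move=> eta_alpha ec ed prodN.
  apply: (dih_elt_const (p_gt5 := p_gt5) (GT := GT) (ab := ab)
    eta_neq0 eta_neq1 prodN).
  have /= prod := dih_elt_mul eta p_prime p_gt2 GT Ta Tb ab c d.
  have := fusion _ _ alpha_mem alpha_mem _ _ ec ed; rewrite prod => prod01.
  suff op01 z : z \in monster_op alpha (- alpha) alpha alpha -> z = 0 \/ z = 1.
    exact: (eigen_sum01 (f := La) op01 prod01).
  apply: monster_op_alpha.
  - by case: eta_alpha => E; move: one_sub_eta_neq0; rewrite E ?oppr_eq0.
  - case: eta_alpha => E; first by rewrite -E eq_sym.
    by rewrite -[alpha]opprK -E opprB eq_sym.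
  - case: eta_alpha => E; first by rewrite -E opprB eq_sym.
    by rewrite -E -[alpha]opprK -E opprB.
rewrite !inE -!orbA => /or4P[/eqP E|/eqP E|/eqP E|/eqP E].
- by rewrite E eqxx in one_neq_me.
- by rewrite E eqxx in one_sub_eta_neq0.
- have := even_vec_mul eta p_prime p_gt5.
  rewrite (prod_const _ _ 1%:~R 3%:~R (or_introl E)).
  + by rewrite subrr => /esym/eqP; rewrite oner_eq0.
  + by rewrite -E; exact: ev_eigen.
  + by rewrite -E; exact: ev_eigen.
  + by move=> i; exact: dih_mulN (expr1n F 2) (even_vecN F 2) (even_vecN F 3).
  + exact: (smooth_neq0_Fp p_prime p_gt5).
  + exact: (smooth_neq0_Fp p_prime p_gt5).
- have := odd_vec_mul eta p_prime p_gt5.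
  rewrite (prod_const _ _ 1%:~R 2%:~R (or_intror E)).
  + by rewrite subrr => /esym/eqP; rewrite oner_eq0.
  + by rewrite -[alpha]opprK -E.
  + by rewrite -[alpha]opprK -E.
  + move=> i; apply: dih_mulN (odd_vecN F) (odd_vecN F).
    by rewrite sqrrN expr1n.
  + exact: (smooth_neq0_Fp p_prime p_gt5).
  + exact: (smooth_neq0_Fp p_prime p_gt5).
Qed.
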